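(* Let $t\in\mathbb{R}$, $t\neq0$, and $\lambda>-1/2$, and let $\{\alpha_n\}$ be the Verblunsky coefficients associated with the weight function $w(\theta)=e^{t\cos(\theta)}[\sin^2(\theta/2)]^{\lambda}$, $0\le\theta\le2\pi$. Then the $\alpha_n$ satisfy the discrete Painlevé II equation $$\alpha_n+\alpha_{n-2}=-\frac{2}{t}\,\frac{\lambda+(\lambda+n)\alpha_{n-1}}{1-\alpha_{n-1}^2},\qquad n\ge2.$$
   Context: $\{\Phi_n\}_{n\ge0}$ is the sequence of monic orthogonal polynomials on the unit circle ($\deg\Phi_n=n$) for the inner product $\langle f,g\rangle=\int_0^{2\pi}f(e^{i\theta})\overline{g(e^{i\theta})}\,w(\theta)\,d\theta$. The Verblunsky coefficients are $\alpha_{n-1}=-\overline{\Phi_n(0)}$ for $n\ge1$; since $w$ is symmetric they are real here. *)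

(* Defs.v *)
From HB Require Import structures.
From mathcomp Require Import all_boot all_order all_algebra.
From mathcomp Require Import complex.
From mathcomp Require Import all_classical all_reals all_analysis.

Set Implicit Arguments.
Unset Strict Implicit.
Unset Printing Implicit Defensive.

Import Order.TTheory GRing.Theory Num.Theory.

Local Open Scope classical_set_scope.
Local Open Scope ring_scope.
Local Open Scope complex_scope.

(** Integral on [[0, 2 pi]] of a complex-valued function with respect to
    Lebesgue measure, taken componentwise. *)
Definition circle_integral (R : realType) (f : R -> R[i]) : R[i] :=
  (\int[@lebesgue_measure R]_(theta in `[0, 2 * pi]) complex.Re (f theta))
  +i* (\int[@lebesgue_measure R]_(theta in `[0, 2 * pi]) complex.Im (f theta)).

Definition expi (R : realType) (theta : R) : R[i] := cos theta +i* sin theta.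

Definition circle_inner (R : realType) (w : R -> R) (f g : {poly R[i]}) :
    R[i] :=
  circle_integral (fun theta =>
    f.[expi theta] * (g.[expi theta])^* * (w theta)%:C).

(** [Phi] is the sequence of monic orthogonal polynomials on the unit circle
    for the weight [w]; [size (Phi n) = n.+1] says that [Phi n] has
    degree [n]. *)
Definition monic_OPUC (R : realType) (w : R -> R) (Phi : nat -> {poly R[i]}) :
    Prop :=
  [/\ forall n, size (Phi n) = n.+1,
      forall n, Phi n \is monic &
      forall m n, m <> n -> circle_inner w (Phi m) (Phi n) = 0].

(** Indexed so that [verblunsky Phi n.-1] is minus the conjugate of
    [(Phi n).[0]] for [n >= 1]. *)
Definition verblunsky (R : realType) (Phi : nat -> {poly R[i]}) (n : nat) :
    R[i] :=
  - ((Phi n.+1).[0])^*.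

(** The real power [`^] sends [0] to [0] when the exponent is nonzero, so this
    weight also takes a finite value at [theta = 0] and [theta = 2 * pi] when
    [lambda < 0]; these two points are negligible for the integral. *)
Definition weight (R : realType) (t lambda theta : R) : R :=
  expR (t * cos theta) * (sin (theta / 2) ^+ 2) `^ lambda.

(* Main.v *)
Require Import Defs.
From mathcomp Require Import all_boot all_order all_algebra.
From mathcomp Require Import complex.
From mathcomp Require Import all_classical all_reals all_analysis.
From mathcomp Require Import measurable_realfun.
From mathcomp Require Import ring lra zify.

(** The moments [m k] of the weight are real and even in [k], and integrating
    the derivative of [(z - 1) z^k w] over the circle gives a linear recurrence
    for them (the Pearson equation: [w' / w = - t sin theta + lambda cot (theta / 2)]
    has its only pole at [z = 1]).  By linearity the recurrence holds with [z^k]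
    replaced by any Laurent polynomial [f].  For [f = Phi_n(z)^2 z^(-n)], each
    term is computed from orthogonality and the Szego recurrence, and the outcome is
    [E_(n+1) = E_n] where
    [E_n = (n + lambda) alpha_(n-1)
           + t / 2 (1 - alpha_(n-1)^2) (alpha_n + alpha_(n-2))].
    With [alpha_(-1) = -1] one has [E_0 = - lambda], and [E_n = - lambda] is the
    discrete Painleve II equation. *)

Set Implicit Arguments.
Unset Strict Implicit.
Unset Printing Implicit Defensive.

Import Order.TTheory GRing.Theory Num.Theory.
Import numFieldNormedType.Exports.

Local Open Scope ring_scope.

(** * Orthogonal polynomials for a symmetric Toeplitz form *)

Section Toeplitz.
Variables (K : fieldType) (m : int -> K).
Hypothesis m_even : forall k, m (- k) = m k.
Implicit Types (p q : {poly K}) (N : int).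

(* [L (z^(-N) p)] for the linear functional [L] with [L z^k = m k]. *)
Definition toep (N : int) (p : {poly K}) : K :=
  \sum_(i < size p) p`_i * m (i%:Z - N).

Lemma toepE d N p : (size p <= d)%N ->
  toep N p = \sum_(i < d) p`_i * m (i%:Z - N).
Proof.
move=> pd; rewrite /toep (big_ord_widen _ (fun i => p`_i * m (i%:Z - N)) pd).
rewrite big_mkcond; apply: eq_bigr => i _; case: ifPn => //.
by rewrite -leqNgt => pi; rewrite nth_default ?mul0r.
Qed.

Lemma toepD N p q : toep N (p + q) = toep N p + toep N q.
Proof.
set d := maxn (size p) (size q).
rewrite !(@toepE d) ?leq_maxl ?leq_maxr ?(leq_trans (size_polyD _ _))//.
by rewrite -big_split/=; apply: eq_bigr => i _; rewrite coefD mulrDl.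
Qed.

Lemma toepZ N c p : toep N (c *: p) = c * toep N p.
Proof.
rewrite (@toepE (size p)) ?size_scale_leq// mulr_sumr.
by apply: eq_bigr => i _; rewrite coefZ mulrA.
Qed.

Lemma toepB N p q : toep N (p - q) = toep N p - toep N q.
Proof. by rewrite -scaleN1r toepD toepZ mulN1r. Qed.

Lemma toep0 N : toep N 0 = 0.
Proof. by rewrite /toep size_poly0 big_ord0. Qed.

Lemma toep_mulX N p : toep N (p * 'X) = toep (N - 1) p.
Proof.
rewrite (@toepE (size p).+1); last first.
  by have [->|p0] := eqVneq p 0; rewrite ?mul0r ?size_poly0// size_mulX.
rewrite big_ord_recl coefMX/= mul0r add0r; apply: eq_bigr => i _.
by rewrite coefMX/= /bump/= ; congr (_ * m _); lia.
Qed.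

Lemma toep_mulXn N p i : toep N (p * 'X^i) = toep (N - i%:Z) p.
Proof.
elim: i N => [|i IH] N; first by rewrite expr0 mulr1 subr0.
by rewrite exprSr mulrA toep_mulX IH; congr (toep _ _); lia.
Qed.

Lemma toepM d N p q : (size q <= d)%N ->
  toep N (p * q) = \sum_(i < d) q`_i * toep (N - i%:Z) p.
Proof.
move=> qd; have {1}-> : q = \sum_(i < d) q`_i *: 'X^i.
  apply/polyP => i; rewrite -poly_def coef_poly; case: ltnP => // di.
  by rewrite nth_default// (leq_trans qd).
rewrite mulr_sumr (big_morph (toep N) (toepD N) (toep0 N)).
by apply: eq_bigr => i _; rewrite -scalerAr toepZ toep_mulXn.
Qed.

(** Both sides are [L (z^(-s) p(1/z) q(z))]: evenness of [m] makes [L] invariant under exchanging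
    [z] and [1/z]. *)
Lemma toep_flip s d d' p q : (size p <= d)%N -> (size q <= d')%N ->
  \sum_(i < d) p`_i * toep (i%:Z + s) q =
  \sum_(j < d') q`_j * toep (j%:Z - s) p.
Proof.
move=> pd qd.
under eq_bigr do rewrite (toepE _ qd) mulr_sumr.
under [RHS]eq_bigr do rewrite (toepE _ pd) mulr_sumr.
rewrite exchange_big; apply: eq_bigr => j _; apply: eq_bigr => i _.
rewrite mulrCA -m_even; congr (_ * (_ * m _)); lia.
Qed.

Definition rev_poly n p : {poly K} := \poly_(i < n.+1) p`_(n - i).

Lemma toep_rev n N p : (size p <= n.+1)%N ->
  toep N (rev_poly n p) = toep (n%:Z - N) p.
Proof.
move=> pn; rewrite (toepE _ pn) (toepE _ (size_poly _ _)).
rewrite (reindex_inj rev_ord_inj); apply: eq_bigr => i _.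
have ni : (i <= n)%N by rewrite -ltnS.
rewrite coef_poly ltn_ord /= subSS subKn// -m_even; congr (_ * m _); lia.
Qed.

(** The operator [z d/dz]: it keeps the degree and produces the factor [i] on [z^i] that matches the
    factor [k] in the moment recurrence. *)
Definition euler p : {poly K} := p^`() * 'X.

Lemma coef_euler p i : (euler p)`_i = p`_i *+ i.
Proof. by rewrite coefMX coef_deriv; case: i. Qed.

Lemma size_euler p : (size (euler p) <= size p)%N.
Proof.
apply/leq_sizeP => j pj; rewrite coef_euler.
by move/leq_sizeP: (leqnn (size p)) => ->; rewrite ?mul0rn.
Qed.

Lemma eulerM p q : euler (p * q) = euler p * q + p * euler q.
Proof. by rewrite /euler derivM; ring. Qed.

(** * Szego recurrence and first integral, with [t2] standing for [t / 2] *)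

Section Pearson.
Variables (t2 lam : K).
Hypothesis pearson : forall k : int,
  k%:~R * (m (k + 1) - m k) + m (k + 1)
  + t2 * (m (k + 2) - m (k + 1) - m k + m (k - 1))
  + lam * (m (k + 1) + m k) = 0.

(** This is [pearson] at [k = i - N], weighted by the coefficients [p_i]: the part [i] of the factor
    [k] is absorbed in [euler], the part [- N] stays outside. *)
Lemma toep_pearson N p :
  toep (N - 1) (euler p) - toep N (euler p)
  - N%:~R * (toep (N - 1) p - toep N p) + toep (N - 1) p
  + t2 * (toep (N - 2) p - toep (N - 1) p - toep N p + toep (N + 1) p)
  + lam * (toep (N - 1) p + toep N p) = 0.
Proof.
rewrite !(toepE _ (size_euler p)) /toep.
rewrite -?sumrB -?big_split/= mulr_sumr -?sumrB -?big_split/=.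
rewrite !mulr_sumr -?sumrB -?big_split/= big1// => i _.
rewrite coef_euler -[RHS](mulr0 p`_i) -(pearson (i%:Z - N)).
have -> : i%:Z - (N - 1) = i%:Z - N + 1 by lia.
have -> : i%:Z - (N - 2) = i%:Z - N + 2 by lia.
have -> : i%:Z - (N + 1) = i%:Z - N - 1 by lia.
rewrite rmorphB/= -mulr_natr -pmulrn; ring.
Qed.

Variable Phi : nat -> {poly K}.
Hypothesis size_Phi : forall n, size (Phi n) = n.+1.
Hypothesis Phi_monic : forall n, Phi n \is monic.
Hypothesis Phi_orth : forall n j : nat, (j < n)%N -> toep j (Phi n) = 0.
Hypothesis Phi_neq0 : forall n : nat, toep n (Phi n) != 0.

Lemma coef_Phi_top n : (Phi n)`_n = 1.
Proof. by have /monicP := Phi_monic n; rewrite lead_coefE size_Phi. Qed.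

(** Pairing [p] with [Phi n] by [toep_flip] gives 0 on one side and, by orthogonality, [p_n] times
    the norm of [Phi n] on the other. So the top coefficient vanishes and the degree drops. *)
Lemma toep_nondegenerate n p : (size p <= n)%N ->
  (forall j : nat, (j < n)%N -> toep j p = 0) -> p = 0.
Proof.
elim: n => [|n IH] pn p0; first by apply/eqP; rewrite -size_poly_leq0.
have sPhi : (size (Phi n) <= n.+1)%N by rewrite size_Phi.
have := toep_flip 0 sPhi pn.
rewrite big1 => [|i _]; last by rewrite addr0 p0 ?mulr0.
rewrite big_ord_recr/= big1 => [|i _]; last by rewrite subr0 Phi_orth ?mulr0.
rewrite add0r subr0 => /esym/eqP; rewrite mulf_eq0 (negPf (Phi_neq0 n)) orbF.
move=> /eqP pn0; apply: IH => [|j jn]; last exact/p0/ltnW.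
apply/leq_sizeP => j; rewrite leq_eqVlt => /predU1P[<-//|nj].
by move/leq_sizeP: pn => ->.
Qed.

(* The index is shifted, [b n = alpha_(n-1)], so that [b 0 = -1] is the usual
   convention for [alpha_(-1)]. *)
Let b n := - (Phi n)`_0.

(** The difference [f] of the two sides has no constant term and no term of degree [n + 1], so
    [f = z g] with [g] of degree less than [n]; orthogonality kills [g] against every [z^j] with
    [j < n], and nondegeneracy gives [g = 0]. *)
Lemma szego n : Phi n.+1 = Phi n * 'X - b n.+1 *: rev_poly n (Phi n).
Proof.
apply/eqP; rewrite -subr_eq0; set f := _ - _.
pose g : {poly K} := \poly_(i < n) f`_i.+1.
have fE : f = g * 'X.
  apply/polyP => -[|i].
    rewrite coefMX /f coefB coefB coefMX coefZ coef_poly/= subn0 coef_Phi_top.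
    by rewrite /b; ring.
  rewrite coefMX/= coef_poly; case: ltnP => // ni.
  rewrite /f coefB coefB coefMX coefZ coef_poly ltnNge ltnS ni/= mulr0 subr0.
  move: ni; rewrite leq_eqVlt => /predU1P[<-|ni].
    by rewrite !coef_Phi_top subrr.
  by rewrite !nth_default ?subrr// size_Phi.
rewrite fE (@toep_nondegenerate n g) ?mul0r// ?size_poly// => j jn.
have -> : toep j g = toep j.+1 f.
  by rewrite fE toep_mulX; congr (toep _ _); lia.
rewrite /f !toepB Phi_orth ?toepZ ?toep_mulX ?toep_rev ?size_Phi//.
have -> : j.+1%:Z - 1 = j by lia.
have -> : n%:Z - j.+1%:Z = (n - j.+1)%N by lia.
by rewrite !Phi_orth; [ring|lia|].
Qed.

(** [h n] is the squared norm of [Phi n], which is monic and orthogonal to lower powers. [l n] is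
    its coefficient of degree [n - 1]; the factor ['X] makes it 0 at [n = 0]. *)
Let h (n : nat) := toep n (Phi n).
Let l n := (Phi n * 'X)`_n.

(** [Phi (n + 1)] is orthogonal to 1; expand it by [szego]. *)
Lemma toepPhi_m1 n : toep (- 1) (Phi n) = b n.+1 * h n.
Proof.
have := @Phi_orth n.+1 0%N isT; rewrite szego toepB toepZ toep_mulX toep_rev ?size_Phi//.
by rewrite sub0r subr0 -/(h n) => /eqP; rewrite subr_eq0 => /eqP.
Qed.

(** Flip [Phi n] against itself with shift 1. The left side keeps the indices [n] and [n - 1], the
    latter giving [l n * h n]; the right side keeps only the constant coefficient, times
    [toep (- 1) (Phi n)]. *)
Lemma toepPhi_next n : toep n.+1 (Phi n) = - (b n * b n.+1 + l n) * h n.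
Proof.
have sPhi : (size (Phi n) <= n.+1)%N by rewrite size_Phi.
have := toep_flip 1 sPhi sPhi.
rewrite [in RHS]big_ord_recl/= [in RHS]big1 => [|i _]; last first.
  rewrite (_ : _ - 1 = Posz i) ?Phi_orth ?mulr0//.
  by rewrite /bump; lia.
rewrite addr0 sub0r toepPhi_m1.
rewrite big_ord_recr/= coef_Phi_top mul1r (_ : n%:Z + 1 = n.+1); last by lia.
suff -> : \sum_(i < n) (Phi n)`_i * toep (i%:Z + 1) (Phi n) = l n * h n.
  by move=> E; apply: (addrI (l n * h n)); rewrite E /b; ring.
rewrite /l coefMX; case: n {sPhi} => [|n]; first by rewrite big_ord0 mul0r.
rewrite big_ord_recr/= big1 => [|i _]; last first.
  by rewrite (_ : _ + 1 = Posz i.+1) ?Phi_orth ?mulr0 ?ltnS//; lia.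
by rewrite add0r (_ : _ + 1 = Posz n.+1)//; lia.
Qed.

Lemma normPhi_rec n : h n.+1 = (1 - b n.+1 ^+ 2) * h n.
Proof.
rewrite /h [Phi n.+1]szego toepB toepZ toep_mulX toep_rev ?size_Phi//.
rewrite (_ : n.+1%:Z - 1 = n); last by lia.
rewrite (_ : n%:Z - n.+1%:Z = -1); last by lia.
by rewrite toepPhi_m1 /h; ring.
Qed.

(** This is the ratio of two successive norms, both nonzero; it is the denominator in the final
    equation. *)
Lemma one_sub_sqr_verblunsky_neq0 n : 1 - b n.+1 ^+ 2 != 0.
Proof. by have := Phi_neq0 n.+1; rewrite -/(h _) normPhi_rec mulf_eq0 => /norP[]. Qed.

(** [toepPhi_m1] at [n + 1], with [Phi (n + 1)] expanded by [szego]. *)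
Lemma toepPhi_m2 n :
  toep (- 2) (Phi n) = b n.+2 * h n.+1 + b n.+1 * toep n.+1 (Phi n).
Proof.
have := toepPhi_m1 n.+1.
rewrite [Phi n.+1]szego toepB toepZ toep_mulX toep_rev ?size_Phi//.
rewrite (_ : _ - - 1 = Posz n.+1); last by lia.
rewrite (_ : - 1 - 1 = -2)// => /eqP; rewrite subr_eq => /eqP ->//.
Qed.

Lemma subleading_rec n : l n.+1 = l n + b n * b n.+1.
Proof.
rewrite /l coefMX/= szego coefB coefZ !coef_poly ltnSn subnn /b; ring.
Qed.

Lemma coef1_Phi n : (Phi n.+1)`_1 = - b n - b n.+1 * l n.
Proof.
rewrite szego coefB coefZ coef_poly [(Phi n * 'X)`_1]coefMX/= /l coefMX /b.
by case: n => [|n]/=; rewrite ?subSS ?subn0; ring.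
Qed.

(** This is [E_(N+1) = E_N] for [N = n + 1], from [toep_pearson] applied to the square of [Phi N].
    Having [N >= 1] guarantees two extreme coefficients to split off at each end; [dPII_base] treats
    [N = 0]. *)
Lemma dPII_difference n :
  n.+2%:R * b n.+2 - n.+1%:R * b n.+1 + lam * (b n.+2 - b n.+1)
  + t2 * ((1 - b n.+2 ^+ 2) * (b n.+3 + b n.+1)
          - (1 - b n.+1 ^+ 2) * (b n.+2 + b n)) = 0.
Proof.
(* With [N] opaque, [normPhi_rec] below reduces [h (N + 1)] to [h N] and goes no further. *)
pose N := n.+1; have NE : N = n.+1 by [].
rewrite -!NE; clearbody N; have sPhi : (size (Phi N) <= N.+1)%N by rewrite size_Phi.
have sE : (size (euler (Phi N)) <= N.+1)%N by rewrite (leq_trans (size_euler _)).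
have := toep_pearson N (Phi N * Phi N).
(* Both halves of the Leibniz rule become the same product [Phi N * euler (Phi N)]. *)
rewrite eulerM [euler _ * _]mulrC !toepD.
(* The indices [N - 1 - i] stay in the range of orthogonality except [-1], at [i = N]. *)
have -> : toep (N%:Z - 1) (Phi N * euler (Phi N)) = N%:R * toep (- 1) (Phi N).
  rewrite (toepM _ _ sE) big_ord_recr big1 => /= [|i _].
    by rewrite add0r coef_euler coef_Phi_top; congr (_ * toep _ _); lia.
  by rewrite (_ : _ - _ = Posz (N.-1 - i)) ?Phi_orth ?mulr0//; have := ltn_ord i; lia.
(* Only [i = 0] leaves the range, and [euler] has no constant term. *)
have -> : toep N (Phi N * euler (Phi N)) = 0.
  rewrite (toepM _ _ sE) big_ord_recl coef_euler mulr0n mul0r add0r.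
  rewrite big1 => // i _.
  rewrite (_ : _ - _ = Posz (N - lift ord0 i)) ?Phi_orth ?mulr0//; rewrite /= /bump/=; have := ltn_ord i; lia.
have -> : toep (N%:Z - 1) (Phi N * Phi N) = toep (- 1) (Phi N).
  rewrite (toepM _ _ sPhi) big_ord_recr big1 => /= [|i _].
    by rewrite add0r coef_Phi_top mul1r; congr (toep _ _); lia.
  by rewrite (_ : _ - _ = Posz (N.-1 - i)) ?Phi_orth ?mulr0//; have := ltn_ord i; lia.
have -> : toep N (Phi N * Phi N) = - b N * h N.
  rewrite (toepM _ _ sPhi) big_ord_recl big1 => /= [|i _].
    by rewrite addr0 subr0 /b opprK.
  rewrite (_ : _ - _ = Posz (N.-1 - i)) ?Phi_orth ?mulr0//; rewrite /bump/=; have := ltn_ord i; lia.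
(* Here two indices leave the range: [-2] and [-1], at the top two coefficients. *)
have -> : toep (N%:Z - 2) (Phi N * Phi N) =
    toep (- 2) (Phi N) + l N * toep (- 1) (Phi N).
  rewrite (toepM _ _ sPhi) NE !big_ord_recr big1 => /= [|i _].
    rewrite add0r coef_Phi_top mul1r [RHS]addrC /l coefMX/=.
    by congr (_ * toep _ _ + toep _ _); lia.
  by rewrite (_ : _ - _ = Posz (n.-1 - i)) ?Phi_orth ?mulr0//; have := ltn_ord i; lia.
(* Now it is [N + 1] and [N], at the bottom two coefficients. *)
have -> : toep (N%:Z + 1) (Phi N * Phi N) =
    - b N * toep N.+1 (Phi N) + (Phi N)`_1 * h N.
  rewrite (toepM _ _ sPhi) NE !big_ord_recl big1 => /= [|i _].
    by rewrite addrA addr0 /b opprK; congr (_ * toep _ _ + _ * toep _ _); rewrite /= /bump/=; lia.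
  rewrite (_ : _ - _ = Posz (n - i)) ?Phi_orth ?mulr0//; rewrite /= /bump/=; have := ltn_ord i; lia.
rewrite toepPhi_m2 toepPhi_next toepPhi_m1 normPhi_rec NE coef1_Phi.
rewrite subleading_rec -pmulrn.
(* Every term is by now a multiple of [h (n + 1)], which is cancelled. *)
move=> E; apply: (mulIf (Phi_neq0 n.+1)); rewrite mul0r -/(h n.+1) -[RHS]E -!natr1.
ring.
Qed.

(** [toep_pearson] with [N = 0] and [Phi 0 = 1], the case in which [euler] vanishes; it says
    [E_1 = - lam]. *)
Lemma dPII_base :
  b 1 + lam * (b 1 + 1) + t2 * (1 - b 1 ^+ 2) * (b 2 - 1) = 0.
Proof.
have Phi0 : Phi 0 = 1.
  by rewrite (size1_polyC (_ : size (Phi 0) <= 1)%N) ?size_Phi// coef_Phi_top.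
have b0 : b 0 = - 1 by rewrite /b coef_Phi_top.
have l0 : l 0 = 0 by rewrite /l coefMX.
have := toep_pearson 0 (Phi 0).
have -> : euler (Phi 0) = 0 by rewrite /euler Phi0 derivC mul0r.
rewrite !toep0 (_ : 0 + 1 = 1%N :> int)// !sub0r.
rewrite toepPhi_m2 toepPhi_next toepPhi_m1 normPhi_rec b0 l0.
rewrite -[toep 0 _]/(h 0) => E.
apply: (mulIf (Phi_neq0 0)); rewrite mul0r -[RHS]E -/(h 0); ring.
Qed.

(** The quantity [E_(n+1)] is constant by [dPII_difference], and [dPII_base] fixes its value. *)
Lemma dPII_first_integral n :
  n.+1%:R * b n.+1 + lam * b n.+1
  + t2 * (1 - b n.+1 ^+ 2) * (b n.+2 + b n) = - lam.
Proof.
elim: n => [|n IH].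
  have b0 : b 0 = - 1 by rewrite /b coef_Phi_top.
  apply/eqP; rewrite -subr_eq0 -[X in _ == X]dPII_base b0; apply/eqP; ring.
rewrite -[RHS]IH; apply/eqP; rewrite -subr_eq0 -[X in _ == X](dPII_difference n).
apply/eqP; ring.
Qed.
End Pearson.
End Toeplitz.

Local Open Scope classical_set_scope.
Local Open Scope ring_scope.

(** * Improper integrals of derivatives *)

Section Improper.
Context {R : realType}.
Notation mu := (@lebesgue_measure R).
Implicit Types (f F : R -> R) (a b c d x : R).

(** Regularity is asked only inside []c, d[], since the derivatives used below may blow up at both
    ends. *)
Lemma integral_derive_oo f F c d a b :
  (forall x, c < x < d -> is_derive x 1 F (f x)) ->
  (forall x, c < x < d -> {for x, continuous f}) ->
  c < a -> a <= b -> b < d ->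
  (\int[mu]_(x in `[a, b]) (f x)%:E = (F b - F a)%:E)%E.
Proof.
move=> dF cf ca; rewrite le_eqVlt => /predU1P[<- _|ab bd].
  by rewrite set_itv1 integral_set1 subrr.
have sub x : x \in `[a, b] -> c < x < d.
  by rewrite in_itv/= => /andP[ax xb]; rewrite (lt_le_trans ca)//= (le_lt_trans xb).
have cF x : x \in `[a, b] -> {for x, continuous F}.
  move=> xab; apply/differentiable_continuous/derivable1_diffP.
  by have [] := dF _ (sub _ xab).
rewrite (@continuous_FTC2 _ f F)//.
- by apply: continuous_in_subspaceT => x; rewrite inE => xab; exact/cf/sub.
- split.
  + by move=> x xab; have [] := dF _ (sub _ (subset_itv_oo_cc xab)).
  + by apply: cvg_at_right_filter; apply: cF; rewrite in_itv/= lexx ltW.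
  + by apply: cvg_at_left_filter; apply: cF; rewrite in_itv/= lexx ltW.
- move=> x xab; rewrite derive1E.
  by have [_ ->] := dF _ (sub _ (subset_itv_oo_cc xab)).
Qed.

(** Exhaust []c, d[] by compact intervals: on each one the integral is a difference of values of
    [F], hence at most [2 M], and monotone convergence concludes. *)
Lemma integrable_ge0_derive_oo f F c d (M : R) : measurable_fun `]c, d[ f ->
  (forall x, c < x < d -> is_derive x 1 F (f x)) ->
  (forall x, c < x < d -> {for x, continuous f}) ->
  (forall x, c < x < d -> 0 <= f x) ->
  (forall x, c < x < d -> `|F x| <= M) ->
  mu.-integrable `]c, d[ (EFin \o f).
Proof.
move=> mf dF cf f0 FM.
pose E (n : nat) : set (measurableTypeR R) := `[c + n.+1%:R^-1, d - n.+1%:R^-1]%classic.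
have invS0 n : 0 < n.+1%:R^-1 :> R by rewrite invr_gt0.
have subE n x : E n x -> c < x < d.
  rewrite /E/= in_itv/= => /andP[cx xd].
  by rewrite (lt_le_trans _ cx) ?ltrDl//= (le_lt_trans xd)// gtrBl.
have UE : `]c, d[%classic = \bigcup_n E n.
  apply/seteqP; split => x/=; last first.
    by move=> [n _ /subE]; rewrite in_itv.
  rewrite in_itv/= => /andP[cx xd].
  have e0 : 0 < Num.min (x - c) (d - x) by rewrite lt_min !subr_gt0 cx.
  have [n nP] := ltr_add_invr e0.
  exists n => //; rewrite /E/= in_itv/=; move: nP; rewrite add0r lt_min => /andP[].
  by move: (n.+1%:R^-1) => e h1 h2; apply/andP; split; lra.
have mE n : measurable (E n) by exact: measurable_itv.
have mfE n : measurable_fun (E n) f.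
  by apply: measurable_funS mf => // x /subE; rewrite /= in_itv.
have ndE : nondecreasing_seq E.
  move=> n m nm; apply/subsetPset => x; rewrite /E/= !in_itv/= => /andP[cx xd].
  have : m.+1%:R^-1 <= n.+1%:R^-1 :> R by rewrite lef_pV2 ?posrE ?ler_nat.
  by move: (n.+1%:R^-1) (m.+1%:R^-1) cx xd => e e' cx xd h; apply/andP; split; lra.
apply/integrableP; split; first exact/measurable_EFinP.
rewrite UE.
under eq_integral => x.
  rewrite inE => -[n _ /subE/f0 fx]; rewrite /= ger0_norm//; over.
have /cvg_lim <-// : (\int[mu]_(x in E i) (f x)%:E @[i --> \oo] -->
    \int[mu]_(x in \bigcup_i E i) (f x)%:E)%E.
  apply: ge0_nondecreasing_set_cvg_integral => //.
  - by move=> i; exact/measurable_EFinP.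
  - by move=> i x /subE/f0; rewrite lee_fin.
(* The maximum with 0 covers an empty [E n], where the integral is 0 and [M] need not be
   nonnegative. *)
apply: (@le_lt_trans _ _ (Num.max 0 (M + M))%:E); last exact: ltry.
apply: lime_le.
  apply: ereal_nondecreasing_is_cvgn.
  apply: ge0_nondecreasing_set_nondecreasing_integral => //.
  - by move=> i; exact/measurable_EFinP.
  - by move=> i x /subE/f0; rewrite lee_fin.
apply: nearW => n.
have [ab|ba] := leP (c + n.+1%:R^-1) (d - n.+1%:R^-1); last first.
  by rewrite /E set_itv_ge ?integral_set0 ?lee_fin ?le_max ?lexx// -leNgt bnd_simp.
have [ai bi] : c < c + n.+1%:R^-1 /\ d - n.+1%:R^-1 < d.
  by rewrite ltrDl gtrBl invS0.
rewrite (integral_derive_oo dF)// lee_fin le_max; apply/orP; right.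
rewrite (le_trans (ler_norm _))// (le_trans (ler_normB _ _))// lerD// FM//.
  by rewrite bi (lt_le_trans ai).
by rewrite ai (le_lt_trans ab).
Qed.

(** With [I x] the integral from [c] to [x], [I - F] is constant on []c, d[]; its limits at the two
    ends are compared. *)
Lemma Rintegral_derive_oo f F c d lc ld : c < d ->
  mu.-integrable `[c, d] (EFin \o f) ->
  (forall x, c < x < d -> is_derive x 1 F (f x)) ->
  (forall x, c < x < d -> {for x, continuous f}) ->
  F x @[x --> c^'+] --> lc -> F x @[x --> d^'-] --> ld ->
  \int[mu]_(x in `[c, d]) f x = ld - lc.
Proof.
move=> cd fi dF cf Fc Fd.
pose I x := \int[mu]_(t in `[c, x]) f t.
pose mid := (c + d) / 2.
have IB a b : c < a -> a <= b -> b < d -> I b - I a = F b - F a.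
  move=> ca ab bd; rewrite /I Rintegral_itvB ?bnd_simp//.
  - rewrite Rintegral_itv_obnd_cbnd; last first.
      apply: integrableS fi => //; apply: subset_itv; rewrite bnd_simp; exact: ltW.
    by rewrite /Rintegral (integral_derive_oo dF).
  - apply: integrableS fi => //; apply: subset_itvl; rewrite bnd_simp; exact: ltW.
  - exact: ltW.
have IF x : c < x < d -> I x - F x = I mid - F mid.
  move=> /andP[cx xd]; have [m1 m2] : c < mid /\ mid < d by rewrite /mid; lra.
  by have [xm|mx] := leP x mid; [have := IB _ _ cx xm m2|have := IB _ _ m1 (ltW mx) xd]; lra.
have Ic : I x @[x --> c^'+] --> 0.
  by apply: cvg_at_right_filter; exact: (parameterized_integral_cvg_left cd fi).
have Id : I x @[x --> d^'-] --> I d.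
  exact: (parameterized_integral_cvg_at_left cd fi).
have kc : I mid - F mid = 0 - lc.
  apply: (cvg_unique _ _ (cvgB Ic Fc)) => //.
  apply: cvg_near_cst; near=> x; apply: IF.
  by apply/andP; split; near: x; [exact: nbhs_right_gt|exact: nbhs_right_lt].
have kd : I mid - F mid = I d - ld.
  apply: (cvg_unique _ _ (cvgB Id Fd)) => //.
  apply: cvg_near_cst; near=> x; apply: IF.
  by apply/andP; split; near: x; [exact: nbhs_left_gt|exact: nbhs_left_lt].
rewrite -/(I d); lra.
Unshelve. all: by end_near. Qed.

End Improper.

(** * Moments of the weight *)

Section SinPowers.
Context {R : realType}.
Notation mu := (@lebesgue_measure R).
Implicit Types (k p q x : R).

Lemma sin_half_gt0 x : 0 < x < 2 * pi -> 0 < sin (x / 2).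
Proof.
move=> /andP[x0 x2]; apply: sin_gt0_pi.
by rewrite divr_gt0//= ltr_pdivrMr// mulrC.
Qed.

Lemma sin_half_ge0 x : 0 <= x <= 2 * pi -> 0 <= sin (x / 2).
Proof.
move=> /andP[x0 x2]; apply: sin_ge0_pi.
by rewrite divr_ge0//= ler_pdivrMr// mulrC.
Qed.

Lemma is_derive_mull k x : is_derive x 1 ( *%R k) k.
Proof. by apply: is_derive_eq; rewrite /GRing.scale/= mulr1. Qed.

Lemma is_derive_sin_mull k x :
  is_derive x 1 (fun y => sin (k * y)) (k * cos (k * x)).
Proof.
rewrite mulrC; exact: (is_derive1_comp (is_derive_sin _) (is_derive_mull k x)).
Qed.

Lemma is_derive_cos_mull k x :
  is_derive x 1 (fun y => cos (k * y)) (- (k * sin (k * x))).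
Proof.
rewrite mulrC -mulNr.
exact: (is_derive1_comp (is_derive_cos _) (is_derive_mull k x)).
Qed.

Lemma is_derive_sin_half_powR q x : 0 < x < 2 * pi ->
  is_derive x 1 (fun y => sin (y / 2) `^ q)
    (q * sin (x / 2) `^ (q - 1) * (cos (x / 2) / 2)).
Proof.
move=> x02; have d := is_derive_sin_mull 2^-1 x.
have e (y : R) : y / 2 = 2^-1 * y by rewrite mulrC.
rewrite [X in is_derive _ _ X](_ : _ = (fun z : R => z `^ q) \o (fun y : R => sin (2^-1 * y))).
  rewrite !e; move: (sin_half_gt0 x02); rewrite e => s0.
  exact: (is_derive1_comp (is_derive1_powR q s0) d).
by apply/funext => y /=; rewrite e.
Qed.

Lemma continuous_cos_mull k : continuous (fun x => cos (k * x)).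
Proof.
move=> x; apply: (@continuous_comp _ _ _ ( *%R k) cos); last exact: continuous_cos.
exact: mulrl_continuous.
Qed.

Lemma continuous_sin_mull k : continuous (fun x => sin (k * x)).
Proof.
move=> x; apply: (@continuous_comp _ _ _ ( *%R k) sin); last exact: continuous_sin.
exact: mulrl_continuous.
Qed.

Lemma continuous_sin_half : continuous (fun x : R => sin (x / 2)).
Proof. by under eq_fun do rewrite mulrC; exact: continuous_sin_mull. Qed.

Lemma continuous_sin_half_powR q x : 0 < x < 2 * pi ->
  {for x, continuous (fun y : R => sin (y / 2) `^ q)}.
Proof.
move=> x02; apply/differentiable_continuous/derivable1_diffP.
by have [] := is_derive_sin_half_powR q x02.
Qed.

Lemma measurable_sin_half_powR q :
  measurable_fun [set: R] (fun y : R => sin (y / 2) `^ q).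
Proof.
apply: (@measurableT_comp _ _ _ _ _ _ (@powR R ^~ q)) => //.
exact: continuous_measurable_fun continuous_sin_half.
Qed.

(** Positivity makes [h] tend to 0 from the right, the side on which [powR_cvg0] applies. *)
Lemma powR_cvg0_pos (F : set_system R) {FF : Filter F} (h : R -> R) q :
  0 < q -> h x @[x --> F] --> 0 -> (\forall x \near F, 0 < h x) ->
  h x `^ q @[x --> F] --> 0.
Proof.
move=> q0 h0 hpos; apply: cvg_comp (powR_cvg0 q0) => A /= HA.
have := h0 _ HA; apply: filterS2 hpos => x; exact: (fun a b => b a).
Qed.

Lemma sin_half_powR_cvg0_right q : 0 < q ->
  sin (x / 2) `^ q @[x --> (0:R)^'+] --> 0.
Proof.
move=> q0; apply: powR_cvg0_pos => //.
  apply: cvg_at_right_filter.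
  by have := @continuous_sin_half 0; rewrite /continuous_at mul0r sin0.
near=> x; apply: sin_half_gt0; apply/andP; split => //.
by near: x; apply: nbhs_right_lt; rewrite mulr_gt0// pi_gt0.
Unshelve. all: by end_near. Qed.

Lemma sin_half_powR_cvg0_left q : 0 < q ->
  sin (x / 2) `^ q @[x --> (2 * pi : R)^'-] --> 0.
Proof.
move=> q0; apply: powR_cvg0_pos => //.
  apply: cvg_at_left_filter; have := @continuous_sin_half (2 * pi).
  by rewrite /continuous_at mulrAC divff// mul1r sinpi.
near=> x; apply: sin_half_gt0; apply/andP; split => //.
by near: x; apply: nbhs_left_gt; rewrite mulr_gt0// pi_gt0.
Unshelve. all: by end_near. Qed.

Lemma powRS x q : 0 < x -> x `^ (q + 1) = x `^ q * x.
Proof. by move=> x0; rewrite powRD ?powRr1 ?(ltW x0)// (gt_eqF x0) implybT. Qed.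

Lemma powR_le1 x q : 0 <= x <= 1 -> 0 <= q -> x `^ q <= 1.
Proof.
move=> /andP[x0 x1] q0; have := @ge0_ler_powR R q q0 x 1.
by rewrite !nnegrE x0 ler01 powR1; exact.
Qed.

(* (p + 1) s^p - (p + 2) s^(p + 2) is the derivative of 2 cos (x / 2) s^(p + 1),
   which is bounded, and s^(p + 2) <= 1: hence a bound for the integral of s^p
   that takes care of both end points. *)
Lemma integrable_sin_half_powR p : -1 < p ->
  mu.-integrable `[0, 2 * pi] (EFin \o (fun x => sin (x / 2) `^ p)).
Proof.
move=> p1; have pi2 : 0 < 2 * pi :> R by rewrite mulr_gt0// pi_gt0.
have p10 : 0 < p + 1 by lra.
pose s (x : R) := sin (x / 2).
(* The added constant [p + 2] dominates [(p + 2) s^(p + 2)], so [f >= (p + 1) s^p >= 0]; it accounts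
   for the linear term of [F]. *)
pose f x := (p + 1) * s x `^ p - (p + 2) * s x `^ (p + 2) + (p + 2).
pose F (x : R) := 2 * cos (2^-1 * x) * s x `^ (p + 1) + (p + 2) * x.
have mf : measurable_fun [set: R] f.
  apply: measurable_funD => //; apply: measurable_funB;
  by apply: measurable_funM => //; exact: measurable_sin_half_powR.
have sle1 x q : 0 < x < 2 * pi -> 0 <= q -> s x `^ q <= 1.
  by move=> /sin_half_gt0/ltW s0 q0; rewrite powR_le1// s0 sin_le1.
have fge x : 0 < x < 2 * pi -> (p + 1) * s x `^ p <= f x.
  move=> x02; rewrite /f -addrA lerDl addrC subr_ge0.
  by rewrite ler_piMr ?sle1//; lra.
have iof : mu.-integrable `]0, 2 * pi[ (EFin \o f).
  apply: (@integrable_ge0_derive_oo _ f F _ _ (2 + (p + 2) * (2 * pi))).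
  - exact: measurable_funTS.
  - move=> x x02; have s0 := sin_half_gt0 x02.
    apply: (is_derive_eq (is_deriveD (is_deriveM (is_deriveZ 2
      (is_derive_cos_mull 2^-1 x)) (is_derive_sin_half_powR (p + 1) x02))
      (is_derive_mull (p + 2) x))).
    rewrite /GRing.scale/= addrK /f /s (_ : p + 2 = p + 1 + 1); last lra.
    rewrite !powRS// [2^-1 * x]mulrC.
    have := cos2Dsin2 (x / 2); move: s0; move: (sin _) (cos _) => S C s0 CS.
    rewrite (_ : 2 *: C = 2 * C)//.
    (* The two sides agree only modulo [C^2 + S^2 = 1]: this multiple of the relation is added to
       both and set to 0 on the right. *)
    apply: (addrI (- ((p + 1) * S `^ p * (C ^+ 2 + S ^+ 2 - 1)))).
    by rewrite [in RHS]CS; field.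
  - move=> x x02; rewrite /f.
    apply: cvgD; last exact: cvg_cst.
    by apply: cvgB; (apply: cvgM; first exact: cvg_cst); exact: continuous_sin_half_powR.
  - move=> x x02; apply: le_trans (fge _ x02).
    by rewrite mulr_ge0 ?powR_ge0//; lra.
  - move=> x x02; rewrite (le_trans (ler_normD _ _))// lerD//.
      rewrite !normrM normr_nat -mulrA ler_piMr// mulr_ile1 ?normr_ge0//.
        by rewrite ler_norml cos_geN1 cos_le1.
      by rewrite ger0_norm ?powR_ge0// sle1//; lra.
    case/andP: x02 => x0 x2.
    rewrite normrM !ger0_norm ?ler_pM2l//; lra.
have io : mu.-integrable `]0, 2 * pi[ (EFin \o (fun x => sin (x / 2) `^ p)).
  apply: (@le_integrable _ _ _ mu _ _ _ (fun x => (p + 1)^-1%:E * (f x)%:E)%E) => //.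
  - by apply/measurable_EFinP; apply: measurable_funTS; exact: measurable_sin_half_powR.
  - move=> x; rewrite /= in_itv/= => x02.
    rewrite lee_fin ger0_norm ?powR_ge0// (le_trans _ (ler_norm _))//.
    by rewrite -(ler_pM2l p10) mulVKf ?gt_eqF// fge.
  - exact: integrableZl.
move: io => /integrableP[_ io]; apply/integrableP; split.
  by apply/measurable_EFinP; apply: measurable_funTS; exact: measurable_sin_half_powR.
rewrite integral_itv_bndoo//; apply/measurable_EFinP/measurable_funTS.
by apply: measurableT_comp => //; exact: measurable_sin_half_powR.
Qed.
End SinPowers.

(** * Trigonometric identities *)

Section Trig.
Context {R : realType}.
Implicit Types x y : R.
(** For [y = k x] this exhibits the factor [sin (x / 2)] that cancels the pole of [cot (x / 2)];
    [cos_shift_add] turns the remaining product back into a sum of cosines. *)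
Lemma sin_shift_sub x y :
  sin (y + x) - sin y = 2 * sin (x / 2) * cos (y + x / 2).
Proof.
have [e1 e2] : y + x = y + x / 2 + x / 2 /\ y = y + x / 2 - x / 2 by split; field.
by rewrite [in LHS]e1 [in X in _ - X]e2 sinB sinD; ring.
Qed.

Lemma cos_shift_add x y :
  cos (y + x) + cos y = 2 * cos (x / 2) * cos (y + x / 2).
Proof.
have [e1 e2] : y + x = y + x / 2 + x / 2 /\ y = y + x / 2 - x / 2 by split; field.
by rewrite [in LHS]e1 [in X in _ + X]e2 cosB cosD; ring.
Qed.

Lemma sin_mul_sin x y : 2 * (sin y * sin x) = cos (y - x) - cos (y + x).
Proof. by rewrite cosB cosD; ring. Qed.
End Trig.

(** * Trigonometric moments and their Pearson recurrence *)

Section Moments.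
Context {R : realType}.
Variables (t lam : R).
Hypothesis lam_gt : - (1 / 2) < lam.
Notation mu := (@lebesgue_measure R).
Implicit Types (x : R) (k : int).

(* Equal to [weight t lam] on [[0, 2 pi]] only. *)
Definition circle_weight x : R := expR (t * cos x) * sin (x / 2) `^ (2 * lam).
Local Notation W := circle_weight.

Lemma circle_weightE x : 0 <= x <= 2 * pi -> weight t lam x = W x.
Proof.
move=> /sin_half_ge0 s0; rewrite /weight /W powRrM; congr (_ * _ `^ _).
by rewrite powR_mulrn.
Qed.

Lemma measurable_circle_weight : measurable_fun [set: R] W.
Proof.
apply: measurable_funM; last exact: measurable_sin_half_powR.
apply: measurableT_comp => //; apply: measurable_funM => //.
by apply: continuous_measurable_fun; exact: continuous_cos.
Qed.

(** As [2 lam > -1], the power of the sine is integrable, and the other factors are bounded by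
    [M e^|t|]. *)
Lemma integrable_weightM (h : R -> R) M : measurable_fun [set: R] h ->
  (forall x, `|h x| <= M) ->
  mu.-integrable `[0, 2 * pi] (EFin \o (fun x => h x * W x)).
Proof.
move=> mh hM; have p1 : -1 < 2 * lam by move: lam_gt; lra.
have := integrable_sin_half_powR p1.
move=> /(@integrableMr _ _ _ mu _ _ (fun x => h x * expR (t * cos x)) _).
move=> H; apply: eq_integrable (H _ _ _) => //.
- by move=> x _ /=; rewrite -EFinM /W mulrA.
- apply: measurable_funTS; apply: measurable_funM => //.
  apply: measurableT_comp => //; apply: measurable_funM => //.
  by apply: continuous_measurable_fun; exact: continuous_cos.
- exists (M * expR `|t|); split; first exact: num_real.
  move=> y yM x _ /=; rewrite (le_trans _ (ltW yM))// normrM ler_pM//.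
  rewrite ger0_norm ?expR_ge0// ler_expR (le_trans (ler_norm _))// normrM.
  by rewrite ler_piMr// ler_norml cos_geN1 cos_le1.
Qed.

Lemma continuous_circle_weight x : 0 < x < 2 * pi -> {for x, continuous W}.
Proof.
move=> x02; apply: cvgM; last exact: continuous_sin_half_powR.
apply: continuous_comp; last exact: continuous_expR.
by apply: cvgM; [exact: cvg_cst|exact: continuous_cos].
Qed.

Definition cos_moment k : R := \int[mu]_(x in `[0, 2 * pi]) (cos (k%:~R * x) * W x).

Lemma cos_momentN k : cos_moment (- k) = cos_moment k.
Proof.
by apply: eq_Rintegral => x _; rewrite rmorphN/= mulNr cosN.
Qed.

(** Cosine polynomials are lists of coefficients and frequencies, so that a linear relation between
    moments comes from a single list. *)
Definition cos_poly (s : seq (R * int)) x : R := \sum_(u <- s) u.1 * cos (u.2%:~R * x).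

Lemma continuous_cos_poly s : continuous (cos_poly s).
Proof.
move=> x; rewrite /cos_poly; elim: s => [|u s IH].
  by under eq_fun do rewrite big_nil; exact: cvg_cst.
under eq_fun do rewrite big_cons.
by apply: cvgD IH; apply: cvgM; [exact: cvg_cst|exact: continuous_cos_mull].
Qed.

Lemma cos_poly_bound s x : `|cos_poly s x| <= \sum_(u <- s) `|u.1|.
Proof.
rewrite (le_trans (ler_norm_sum _ _ _))// ler_sum// => u _.
by rewrite normrM ler_piMr// ler_norml cos_geN1 cos_le1.
Qed.

Lemma integrable_cos_poly s :
  mu.-integrable `[0, 2 * pi] (EFin \o (fun x => cos_poly s x * W x)).
Proof.
apply: (integrable_weightM _ (cos_poly_bound s)).
by apply: continuous_measurable_fun; exact: continuous_cos_poly.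
Qed.

Lemma Rintegral_cos_poly s :
  \int[mu]_(x in `[0, 2 * pi]) (cos_poly s x * W x) =
  \sum_(u <- s) u.1 * cos_moment u.2.
Proof.
elim: s => [|u s IH].
  under eq_Rintegral do rewrite /cos_poly big_nil mul0r.
  by rewrite big_nil Rintegral_cst// mul0r.
have icos : mu.-integrable `[0, 2 * pi] (EFin \o (fun x => cos (u.2%:~R * x) * W x)).
  apply: eq_integrable (integrable_cos_poly [:: (1, u.2)]) => // x _ /=.
  by rewrite /cos_poly big_seq1 mul1r.
rewrite big_cons -IH /cos_moment -RintegralZl// -RintegralD//.
- by apply: eq_Rintegral => x _; rewrite /cos_poly big_cons mulrDl mulrA.
- apply: eq_integrable (integrable_cos_poly [:: u]) => // x _ /=.
  by rewrite /cos_poly big_seq1 mulrA.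
- exact: integrable_cos_poly.
Qed.

Lemma is_derive_circle_weight x : 0 < x < 2 * pi ->
  is_derive x 1 W (expR (t * cos x) * (- (t * sin x)) * sin (x / 2) `^ (2 * lam)
   + expR (t * cos x) * (2 * lam * sin (x / 2) `^ (2 * lam - 1) * (cos (x / 2) / 2))).
Proof.
move=> x02.
have dc : is_derive x 1 (fun x => t * cos x) (- (t * sin x)).
  apply: (is_derive_eq (is_deriveZ t (is_derive_cos x))).
  by rewrite /GRing.scale/= mulrN.
apply: (is_derive_eq (is_deriveM (is_derive1_comp (is_derive_expR _) dc)
  (is_derive_sin_half_powR (2 * lam) x02))).
by rewrite /GRing.scale/= addrC mulrC.
Qed.

(** The derivative of [(sin ((k + 1) x) - sin (k x)) W], divided by [W]: two terms from the sines,
    four from [- t sin x], two from [lam cot (x / 2)]. *)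
Definition pearson_terms k : seq (R * int) :=
  [:: ((k + 1)%:~R, k + 1); (- k%:~R, k); (- (t / 2), k); (t / 2, k + 2);
      (t / 2, k - 1); (- (t / 2), k + 1); (lam, k + 1); (lam, k)].

Lemma is_derive_pearson k x : 0 < x < 2 * pi ->
  is_derive x 1 (fun x => (sin ((k + 1)%:~R * x) - sin (k%:~R * x)) * W x)
    (cos_poly (pearson_terms k) x * W x).
Proof.
move=> x02; have s0 := sin_half_gt0 x02.
apply: (is_derive_eq (is_deriveM (is_deriveB (is_derive_sin_mull _ _)
  (is_derive_sin_mull _ _)) (is_derive_circle_weight x02))).
rewrite /cos_poly !big_cons big_nil /= /GRing.scale/= !fctE.
have -> : (k + 1)%:~R * x = k%:~R * x + x by rewrite rmorphD/=; ring.
have -> : (k + 2)%:~R * x = k%:~R * x + x + x by rewrite rmorphD/=; ring.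
have -> : (k - 1)%:~R * x = k%:~R * x - x by rewrite rmorphB/=; ring.
(* All powers of the sine are brought to the exponent [2 lam - 1], which makes the goal
   polynomial. *)
have S2 : sin (x / 2) `^ (2 * lam) = sin (x / 2) `^ (2 * lam - 1) * sin (x / 2).
  by rewrite -powRS// subrK.
rewrite /W S2; move: (k%:~R * x) (_ `^ _) (expR _) => y P E.
have /eqP := sin_shift_sub x y; have /eqP := cos_shift_add x y.
have /eqP := sin_mul_sin x y; have /eqP := sin_mul_sin x (y + x); rewrite addrK.
move: s0 S2; move: (sin (x / 2)) (cos (x / 2)) (cos (y + x / 2)) => S C Q _ _.
rewrite -subr_eq0 => /eqP h1; rewrite -subr_eq0 => /eqP h2.
rewrite -subr_eq0 => /eqP h3; rewrite -subr_eq0 => /eqP h4.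
apply/eqP; rewrite -subr_eq0; apply/eqP.
(* The difference of the two sides as an explicit combination of the four identities [h1] to
   [h4]. *)
transitivity (lam * E * P * (C * (sin (y + x) - sin y - 2 * S * Q)
                             - S * (cos (y + x) + cos y - 2 * C * Q))
  - (t / 2) * (E * (P * S)) *
    (2 * (sin (y + x) * sin x) - (cos y - cos (y + x + x))
     - (2 * (sin y * sin x) - (cos (y - x) - cos (y + x))))); first by field.
by rewrite h1 h2 h3 h4; ring.
Qed.

(** Integrate the derivative of [is_derive_pearson]; the boundary values vanish. *)
Lemma pearson_cos_moment k :
  k%:~R * (cos_moment (k + 1) - cos_moment k) + cos_moment (k + 1)
  + t / 2 * (cos_moment (k + 2) - cos_moment (k + 1) - cos_moment k
             + cos_moment (k - 1))
  + lam * (cos_moment (k + 1) + cos_moment k) = 0.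
Proof.
have pi2 : 0 < 2 * pi :> R by rewrite mulr_gt0// pi_gt0.
(* In this form the antiderivative has the exponent [2 lam + 1 > 0], so it tends to 0 at both ends
   even if [lam < 0]. *)
have bd x : 0 < x < 2 * pi ->
    2 * cos (k%:~R * x + x / 2) * expR (t * cos x) * sin (x / 2) `^ (2 * lam + 1) =
    (sin ((k + 1)%:~R * x) - sin (k%:~R * x)) * W x.
  move=> /sin_half_gt0 s0; rewrite powRS// /W.
  have -> : (k + 1)%:~R * x = k%:~R * x + x by rewrite rmorphD/=; ring.
  by rewrite sin_shift_sub; ring.
have cb : continuous (fun x => 2 * cos (k%:~R * x + x / 2) * expR (t * cos x)).
  move=> x; apply: cvgM.
    apply: cvgM; first exact: cvg_cst.
    suff : continuous (fun x => cos (k%:~R * x + x / 2)) by exact.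
    under eq_fun do rewrite [_ / 2]mulrC -mulrDl.
    exact: continuous_cos_mull.
  apply: continuous_comp; last exact: continuous_expR.
  by apply: cvgM; [exact: cvg_cst|exact: continuous_cos].
have := @Rintegral_derive_oo R _ _ 0 (2 * pi) 0 0 pi2
  (integrable_cos_poly (pearson_terms k)) (is_derive_pearson k).
rewrite Rintegral_cos_poly subrr => H.
rewrite -[RHS]H; first by rewrite !big_cons big_nil/= rmorphD/=; ring.
- move=> x x02; apply: cvgM; first exact: continuous_cos_poly.
  exact: continuous_circle_weight.
- have lim : (2 * cos (k%:~R * x + x / 2) * expR (t * cos x)
      * sin (x / 2) `^ (2 * lam + 1)) @[x --> 0^'+] --> 0.
    rewrite -[X in _ --> X](mulr0 (2 * cos (k%:~R * 0 + 0 / 2) * expR (t * cos 0))).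
    apply: (cvgM (cvg_at_right_filter (cb 0))); apply: sin_half_powR_cvg0_right.
    by move: lam_gt; lra.
  apply: cvg_trans lim; apply: near_eq_cvg; near=> x; apply: bd.
  by apply/andP; split; near: x; [exact: nbhs_right_gt|exact: nbhs_right_lt].
- have lim : (2 * cos (k%:~R * x + x / 2) * expR (t * cos x)
      * sin (x / 2) `^ (2 * lam + 1)) @[x --> (2 * pi)^'-] --> 0.
    pose y : R := 2 * pi.
    rewrite -[X in _ --> X](mulr0 (2 * cos (k%:~R * y + y / 2) * expR (t * cos y))).
    apply: (cvgM (cvg_at_left_filter (cb y))); apply: sin_half_powR_cvg0_left.
    by move: lam_gt; lra.
  apply: cvg_trans lim; apply: near_eq_cvg; near=> x; apply: bd.
  by apply/andP; split; near: x; [exact: nbhs_left_gt|exact: nbhs_left_lt].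
Unshelve. all: by end_near. Qed.

End Moments.

(** * Integrals over the circle *)

Section Reflection.
Context {R : realType}.
Notation mu := (@lebesgue_measure R).

Lemma preimage_reflect_itv (c a b : R) (ba bb : bool) :
  (fun x => c - x) @^-1` [set` Interval (BSide ba a) (BSide bb b)] =
  [set` Interval (BSide (~~ bb) (c - b)) (BSide (~~ ba) (c - a))].
Proof.
apply/seteqP; split => x /=; rewrite !in_itv; move: ba bb => [] [] /= /andP[h1 h2];
  apply/andP; split; lra.
Qed.

(** The measure is determined by the intervals []a, b]], whose preimages [[c - b, c - a[] have the
    same length. *)
Lemma lebesgue_measure_reflect (c : R) (A : set R) : measurable A ->
  pushforward mu ((fun x => c - x) : _ -> measurableTypeR R) A = mu A.
Proof.
move=> mA; apply/esym.
have mphi : measurable_fun [set: measurableTypeR R] ((fun x => c - x) : _ -> measurableTypeR R).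
  exact: measurable_funB.
apply: lebesgue_measure_unique => //= _ [[a b]] _ <-.
rewrite /pushforward preimage_reflect_itv/= !lebesgue_measure_itv/=.
by rewrite !lte_fin ltrD2l ltrN2 -!EFinD; congr (if _ then _%:E else _); ring.
Qed.

Lemma Rintegral_reflect_odd (f : R -> R) c : measurable_fun [set: R] f ->
  mu.-integrable `[0, c] (EFin \o f) -> (forall x, f (c - x) = - f x) ->
  \int[mu]_(x in `[0, c]) f x = 0.
Proof.
move=> mf fi fN.
have mphi : measurable_fun [set: measurableTypeR R] ((fun x => c - x) : _ -> measurableTypeR R).
  exact: measurable_funB.
have pre : (fun x => c - x) @^-1` `[0, c] = `[0, c]%classic.
  by rewrite preimage_reflect_itv/= subrr subr0.
have := @integral_pushforward _ _ _ _ R _ mphi mu `[0, c] (EFin \o f).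
rewrite pre => H.
have {H} : (\int[mu]_(x in `[0%R, c]) (f x)%:E = \int[mu]_(x in `[0%R, c]) (- f x)%:E)%E.
  rewrite (eq_measure_integral (pushforward mu ((fun x => c - x) : _ -> measurableTypeR R))); last first.
    by move=> A mA _; apply/esym; exact: lebesgue_measure_reflect.
  rewrite H//.
  - by apply: eq_integral => x _ /=; rewrite fN.
  - exact/measurable_EFinP.
  - apply: eq_integrable (integrableN fi) => // x _ /=.
    by rewrite fN.
move=> /(congr1 fine); rewrite -!/(Rintegral _ _ _) => E.
have : \int[mu]_(x in `[0, c]) f x = - \int[mu]_(x in `[0, c]) f x.
  rewrite {1}E -mulN1r -RintegralZl//.
  by apply: eq_Rintegral => x _; rewrite mulN1r.
lra.
Qed.

End Reflection.

Local Open Scope complex_scope.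

(** * Linearity of the circle integral, and complex exponentials *)

Section CircleIntegral.
Context {R : realType}.
Notation mu := (@lebesgue_measure R).
Implicit Types (h g : R -> R[i]) (c : R[i]).

Definition circle_integrable h :=
  mu.-integrable `[0, 2 * pi] (EFin \o (fun x => complex.Re (h x))) /\
  mu.-integrable `[0, 2 * pi] (EFin \o (fun x => complex.Im (h x))).

Lemma circle_integrableD h g : circle_integrable h -> circle_integrable g ->
  circle_integrable (fun x => h x + g x).
Proof.
move=> [h1 h2] [g1 g2]; split.
  apply: eq_integrable (integrableD _ h1 g1) => // x _ /=.
  by rewrite raddfD.
apply: eq_integrable (integrableD _ h2 g2) => // x _ /=.
by rewrite raddfD.
Qed.

Lemma circle_integralD h g : circle_integrable h -> circle_integrable g ->
  circle_integral (fun x => h x + g x) = circle_integral h + circle_integral g.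
Proof.
move=> [h1 h2] [g1 g2]; rewrite /circle_integral.
under eq_Rintegral do rewrite raddfD/=.
rewrite RintegralD//; congr (_ +i* _).
by under eq_Rintegral do rewrite raddfD/=; rewrite RintegralD.
Qed.

Lemma complex_ReM (a b : R[i]) : complex.Re (a * b) =
  complex.Re a * complex.Re b - complex.Im a * complex.Im b.
Proof. by case: a b => [? ?] [? ?]. Qed.

Lemma complex_ImM (a b : R[i]) : complex.Im (a * b) =
  complex.Re a * complex.Im b + complex.Im a * complex.Re b.
Proof. by case: a b => [? ?] [? ?]. Qed.

Lemma circle_integrableZ c h : circle_integrable h ->
  circle_integrable (fun x => c * h x).
Proof.
move=> [h1 h2]; split.
  apply: eq_integrable (integrableB _ (integrableZl _ (complex.Re c) h1)
    (integrableZl _ (complex.Im c) h2)) => // x _ /=.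
  by rewrite complex_ReM.
apply: eq_integrable (integrableD _ (integrableZl _ (complex.Re c) h2)
  (integrableZl _ (complex.Im c) h1)) => // x _ /=.
by rewrite complex_ImM.
Qed.

Lemma circle_integralZ c h : circle_integrable h ->
  circle_integral (fun x => c * h x) = c * circle_integral h.
Proof.
move=> [h1 h2]; rewrite /circle_integral.
have iZ (r : R) (k : R -> R) : mu.-integrable `[0, 2 * pi] (EFin \o k) ->
  mu.-integrable `[0, 2 * pi] (EFin \o (fun x => r * k x)).
  by move=> /(integrableZl _ r) H; apply: eq_integrable (H _).
case: c => a b; rewrite [RHS]/GRing.mul/=; congr (_ +i* _).
  under eq_Rintegral do rewrite complex_ReM/=.
  by rewrite RintegralB ?RintegralZl//; exact: iZ.
under eq_Rintegral do rewrite complex_ImM/=.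
by rewrite RintegralD ?RintegralZl//; exact: iZ.
Qed.

Lemma circle_integrable0 : circle_integrable (fun=> 0).
Proof. by split; apply: eq_integrable (integrable0 _ _). Qed.

Lemma circle_integral0 : circle_integral (fun=> 0 : R[i]) = 0.
Proof. by rewrite /circle_integral Rintegral_cst// mul0r. Qed.

Lemma circle_integral_sum (I : Type) (s : seq I) (H : I -> R -> R[i]) :
  (forall i, circle_integrable (H i)) ->
  circle_integrable (fun x => \sum_(i <- s) H i x) /\
  circle_integral (fun x => \sum_(i <- s) H i x) = \sum_(i <- s) circle_integral (H i).
Proof.
move=> iH; elim: s => [|i s [IH1 IH2]].
  have -> : (fun x => \sum_(i <- [::]) H i x) = fun=> 0.
    by apply/funext => x; rewrite big_nil.
  by rewrite big_nil circle_integral0; split=> //; exact: circle_integrable0.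
have -> : (fun x => \sum_(i <- i :: s) H i x) = fun x => H i x + \sum_(i <- s) H i x.
  by apply/funext => x; rewrite big_cons.
rewrite big_cons -IH2 circle_integralD//; split => //.
exact: circle_integrableD.
Qed.

Lemma expiD (x y : R) : expi (x + y) = expi x * expi y.
Proof.
by rewrite /expi [RHS]/GRing.mul/= cosD sinD; congr (_ +i* _); ring.
Qed.

Lemma expi0 : expi (0 : R) = 1.
Proof. by rewrite /expi cos0 sin0. Qed.

Lemma expiMn (x : R) n : expi x ^+ n = expi (n%:R * x).
Proof.
elim: n => [|n IH]; first by rewrite mul0r expi0.
by rewrite exprS IH -expiD -[n.+1]add1n natrD mulrDl mul1r.
Qed.

Lemma conj_expi (x : R) : Num.conj (expi x) = expi (- x).
Proof. by rewrite /expi cosN sinN. Qed.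

(** Dependence on [i - j] alone is what makes the Gram matrix Toeplitz. *)
Lemma expi_mul_conj (x : R) (i j : nat) :
  expi x ^+ i * (expi x ^+ j)^* = expi ((i%:Z - j%:Z)%:~R * x).
Proof.
by rewrite !expiMn conj_expi -expiD -mulNr -mulrDl rmorphB.
Qed.

End CircleIntegral.

(** * The inner product as a Toeplitz form with real moments *)

Section SinMoments.
Context {R : realType}.
Variables (t lam : R).
Hypothesis lam_gt : - (1 / 2) < lam.
Notation mu := (@lebesgue_measure R).
Local Notation W := (circle_weight t lam).

Lemma cos_period (n : nat) (x : R) : cos (n%:R * (2 * pi) + x) = cos x.
Proof.
by rewrite addrC mulr_natl mulr_natl; exact: (periodicn (@cosD2pi R)).
Qed.

Lemma sin_period (n : nat) (x : R) : sin (n%:R * (2 * pi) + x) = sin x.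
Proof.
by rewrite addrC mulr_natl mulr_natl; exact: (periodicn (@sinD2pi R)).
Qed.

Lemma sin_reflect (k : int) (x : R) :
  sin (k%:~R * (2 * pi - x)) = - sin (k%:~R * x).
Proof.
case: k => n.
  by rewrite -pmulrn mulrBr sin_period sinN.
by rewrite NegzE mulrNz -pmulrn !mulNr !sinN mulrBr sin_period sinN.
Qed.

Lemma integrable_sin_weight (k : int) :
  mu.-integrable `[0, 2 * pi] (EFin \o (fun x => sin (k%:~R * x) * W x)).
Proof.
apply: (integrable_weightM t lam_gt (M := 1)).
  by apply: continuous_measurable_fun; exact: continuous_sin_mull.
by move=> x; rewrite ler_norml sin_geN1 sin_le1.
Qed.

Lemma circle_weight_reflect x : W (2 * pi - x) = W x.
Proof.
have := cos_period 1 (- x); rewrite mul1r cosN /circle_weight => ->.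
have -> : (2 * pi - x) / 2 = pi - x / 2 by field.
by rewrite sinB sinpi cospi; congr (_ * _ `^ _); ring.
Qed.

(** The weight is symmetric about [pi] and the sine is odd about it. *)
Lemma sin_moment0 (k : int) :
  \int[mu]_(x in `[0, 2 * pi]) (sin (k%:~R * x) * W x) = 0.
Proof.
apply: Rintegral_reflect_odd (integrable_sin_weight k) _.
  apply: measurable_funM; last exact: measurable_circle_weight.
  by apply: continuous_measurable_fun; exact: continuous_sin_mull.
by move=> x; rewrite sin_reflect circle_weight_reflect mulNr.
Qed.

Lemma expi_weight (k : int) :
  circle_integrable (fun x => expi (k%:~R * x) * (W x)%:C) /\
  circle_integral (fun x => expi (k%:~R * x) * (W x)%:C) = (cos_moment t lam k)%:C.
Proof.
have ReE x : complex.Re (expi (k%:~R * x) * (W x)%:C) = cos (k%:~R * x) * W x.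
  by rewrite [LHS]complex_ReM /= mulr0 subr0.
have ImE x : complex.Im (expi (k%:~R * x) * (W x)%:C) = sin (k%:~R * x) * W x.
  by rewrite [LHS]complex_ImM /= mulr0 add0r.
split.
  split; last first.
    by apply: eq_integrable (integrable_sin_weight k) => // x _; rewrite /comp ImE.
  apply: eq_integrable (integrable_cos_poly t lam_gt [:: (1, k)]) => // x _.
  by rewrite /comp ReE /cos_poly big_seq1 mul1r.
rewrite /circle_integral.
under eq_Rintegral do rewrite ReE.
under [X in _ +i* X]eq_Rintegral do rewrite ImE.
by rewrite sin_moment0.
Qed.

Definition moment (k : int) : R[i] := (cos_moment t lam k)%:C.

Lemma momentN k : moment (- k) = moment k.
Proof. by rewrite /moment cos_momentN. Qed.

Lemma pearson_moment (k : int) :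
  k%:~R * (moment (k + 1) - moment k) + moment (k + 1)
  + (t / 2)%:C * (moment (k + 2) - moment (k + 1) - moment k + moment (k - 1))
  + lam%:C * (moment (k + 1) + moment k) = 0.
Proof.
rewrite -(rmorph0 (real_complex R)) -(pearson_cos_moment t lam_gt k) /moment.
by rewrite !(rmorphD, rmorphN, rmorphM) /= ?rmorph_int.
Qed.

Lemma circle_inner_integrandE (f g : {poly R[i]}) d x : (size g <= d)%N ->
  0 <= x <= 2 * pi ->
  f.[expi x] * Num.conj g.[expi x] * (weight t lam x)%:C =
  \sum_(j < d) Num.conj g`_j * \sum_(i < size f) f`_i *
    (expi ((i%:Z - j%:Z)%:~R * x) * (W x)%:C).
Proof.
move=> gd /circle_weightE->.
rewrite (horner_coef_wide _ gd) horner_coef rmorph_sum mulr_sumr mulr_suml.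
apply: eq_bigr => j _; rewrite !mulr_suml mulr_sumr; apply: eq_bigr => i _.
by rewrite -expi_mul_conj rmorphM/=; ring.
Qed.

Let sum_integrable (f g : {poly R[i]}) d :
  let h (j : 'I_d) x := \sum_(i < size f) f`_i *
    (expi ((i%:Z - j%:Z)%:~R * x) * (W x)%:C) in
  (forall j, circle_integrable (h j) /\
    circle_integral (h j) = toep moment j f) /\
  circle_integrable (fun x => \sum_(j < d) Num.conj g`_j * h j x) /\
  circle_integral (fun x => \sum_(j < d) Num.conj g`_j * h j x) =
    \sum_(j < d) Num.conj g`_j * toep moment j f.
Proof.
move=> h.
have H (j : 'I_d) : circle_integrable (h j) /\
    circle_integral (h j) = toep moment j f.
  have [h1 h2] := circle_integral_sum (index_enum 'I_(size f))
    (fun i : 'I_(size f) => circle_integrableZ f`_i (expi_weight (i%:Z - j%:Z)).1).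
  split; [exact: h1|rewrite [LHS]h2; apply: eq_bigr => i _].
  by rewrite (circle_integralZ _ (expi_weight _).1) (expi_weight _).2.
have [h1 h2] := circle_integral_sum (index_enum 'I_d)
  (fun j : 'I_d => circle_integrableZ (Num.conj g`_j) (H j).1).
split; [exact: H|split; [exact: h1|rewrite [LHS]h2; apply: eq_bigr => j _]].
by rewrite (circle_integralZ _ (H j).1) (H j).2.
Qed.

Lemma circle_integrable_inner (f g : {poly R[i]}) :
  circle_integrable
    (fun x => f.[expi x] * Num.conj g.[expi x] * (weight t lam x)%:C).
Proof.
have [_ [[h1 h2] _]] := sum_integrable f g (size g).
by split; [apply: eq_integrable h1|apply: eq_integrable h2] => // x;
  rewrite inE/= in_itv => x02 /=; rewrite (circle_inner_integrandE _ (leqnn _) x02).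
Qed.

(** Any bound [d] on the size is allowed, so that several polynomials can be expanded over one
    range. *)
Lemma circle_innerE (f g : {poly R[i]}) d : (size g <= d)%N ->
  circle_inner (weight t lam) f g =
  \sum_(j < d) Num.conj g`_j * toep moment j f.
Proof.
move=> gd; have [_ [_ <-]] := sum_integrable f g d.
by congr (_ +i* _); apply: eq_Rintegral => x; rewrite inE/= in_itv => x02 /=;
  rewrite (circle_inner_integrandE _ gd x02).
Qed.

End SinMoments.

(** * Definiteness of the inner product and reality of [Phi] *)

Section Orthogonality.
Context {R : realType}.
Variables (t lam : R).
Hypothesis lam_gt : - (1 / 2) < lam.
Notation mu := (@lebesgue_measure R).
Local Notation W := (circle_weight t lam).
Local Notation inner := (circle_inner (weight t lam)).
Local Notation m := (moment t lam).

(** On []0, pi[] the angle is recovered from the real part by [acos], so these angles lie in the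
    image of the finite list of roots. *)
Lemma finite_expi_roots (f : {poly R[i]}) : f != 0 ->
  finite_set (`]0, pi[ `&` [set x : R | root f (expi x)]).
Proof.
move=> f0; have [r fE] := closed_field_poly_normal f.
pose g (z : R[i]) := acos (complex.Re z).
apply: (@sub_finite_set _ _ (g @` [set` r])); last exact/finite_image/finite_seq.
move=> x /= [x0 rx]; exists (expi x).
  move: rx; rewrite {1}fE rootZ ?lead_coef_eq0// root_prod_XsubC//.
by rewrite /g /= cosK//; exact: subset_itv_oo_cc.
Qed.

(** Otherwise [|f|^2 w] would vanish almost everywhere, and []0, pi[] would be covered by a null set
    and the finitely many roots of [f]. *)
Lemma inner_self_neq0 (f : {poly R[i]}) : f != 0 -> inner f f != 0.
Proof.
move=> f0; apply/negP => /eqP H.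
pose D : set (measurableTypeR R) := `[0, 2 * pi]%classic.
have mD : measurable D by exact: measurable_itv.
pose g (x : R) : R :=
  complex.Re (f.[expi x] * Num.conj f.[expi x] * (weight t lam x)%:C).
have gE x : g x = (complex.Re f.[expi x] ^+ 2 + complex.Im f.[expi x] ^+ 2)
    * weight t lam x.
  by rewrite /g complex_ReM/= mulr0 subr0; case: (f.[_]) => a b /=; ring.
have g0 x : 0 <= g x.
  by rewrite gE mulr_ge0 ?addr_ge0 ?sqr_ge0// mulr_ge0 ?expR_ge0 ?powR_ge0.
have ig : mu.-integrable D (EFin \o g) by case: (circle_integrable_inner t lam_gt f f).
have : (\int[mu]_(x in D) `|(g x)%:E| = 0)%E.
  under eq_integral do rewrite gee0_abs ?lee_fin ?g0//.
  have := congr1 (@complex.Re R) H => /= Ig.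
  by rewrite -(fineK (integrable_fin_num mD ig)); congr EFin; exact: Ig.
have mg : measurable_fun D (EFin \o g) by case/integrableP: ig.
move/(ae_eq_integral_abs mu mD mg) => gae.
pose Z := `]0, pi[ `&` [set x : R | root f (expi x)].
have Zneg : mu.-negligible Z.
  have cZ : countable Z by exact/finite_set_countable/finite_expi_roots.
  apply/negligibleP; last exact: countable_lebesgue_measure0.
  exact: countable_measurable.
have : mu.-negligible (`]0, pi[%classic : set (measurableTypeR R)).
  apply: negligibleS (negligibleU gae Zneg) => x /= x0.
  have [rx|nrx] := boolP (root f (expi x)); [by right|left].
  have [x1 x2] : 0 < x /\ x < pi by move: x0; rewrite in_itv/= => /andP.
  have x02 : 0 < x < 2 * pi by rewrite x1/=; lra.
  have w0 : 0 < weight t lam x.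
    rewrite circle_weightE ?mulr_gt0 ?expR_gt0 ?powR_gt0 ?sin_half_gt0//.
    by case/andP: x02 => ? ?; rewrite !ltW.
  have Dx : D x by rewrite /D/= in_itv/=; case/andP: x02 => ? ?; rewrite !ltW.
  move=> H0; have /eqP := H0 Dx; rewrite eqe.
  rewrite gE mulf_eq0 (gt_eqF w0) orbF paddr_eq0 ?sqr_ge0// !sqrf_eq0 => e.
  by move: nrx; rewrite /root eq_complex /= e.
move/negligibleP => /(_ (measurable_itv _)) /=.
rewrite lebesgue_measure_itv/= lte_fin pi_gt0 => /eqP.
by rewrite oppr0 adde0 eqe (gt_eqF (pi_gt0 R)).
Qed.

Lemma inner_linear_r (f g1 g2 : {poly R[i]}) (c : R[i]) :
  inner f (c *: g1 + g2) = Num.conj c * inner f g1 + inner f g2.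
Proof.
set d := maxn (size g1) (size g2).
have s1 : (size g1 <= d)%N by exact: leq_maxl.
have s2 : (size g2 <= d)%N by exact: leq_maxr.
have s3 : (size (c *: g1 + g2)%R <= d)%N.
  rewrite (leq_trans (size_polyD _ _))// geq_max s2 andbT.
  exact: leq_trans (size_scale_leq _ _) s1.
rewrite !(circle_innerE t lam_gt f (d := d))// mulr_sumr -big_split/=.
by apply: eq_bigr => j _; rewrite coefD coefZ rmorphD rmorphM/=; ring.
Qed.

Lemma inner_Xn (f : {poly R[i]}) (j : nat) : inner f 'X^j = toep m j f.
Proof.
rewrite (circle_innerE t lam_gt f (d := j.+1)) ?size_polyXn//.
rewrite big_ord_recr/= big1 => [|i _].
  by rewrite coefXn eqxx rmorph1 mul1r add0r.
by rewrite coefXn ltn_eqF// rmorph0 mul0r.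
Qed.

Lemma conj_toep (j : int) (f : {poly R[i]}) :
  Num.conj (toep m j f) = toep m j (map_poly Num.conj f).
Proof.
rewrite /toep size_map_poly rmorph_sum; apply: eq_bigr => i _.
rewrite rmorphM coef_map/=; congr (_ * _).
exact: conjc_real.
Qed.

Variable Phi : nat -> {poly R[i]}.
Hypothesis PhiP : monic_OPUC (weight t lam) Phi.

Let size_Phi n : size (Phi n) = n.+1. Proof. by case: PhiP. Qed.
Let Phi_monic n : Phi n \is monic. Proof. by case: PhiP. Qed.

(** Pairwise orthogonality passes to all polynomials of lower degree by removing the top term of [g]
    with a multiple of [Phi k]. *)
Lemma inner_Phi_small n k (g : {poly R[i]}) :
  (size g <= k)%N -> (k <= n)%N -> inner (Phi n) g = 0.
Proof.
elim: k g => [|k IH] g gk kn.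
  have -> : g = 0 by apply/eqP; rewrite -size_poly_leq0.
  by rewrite (circle_innerE t lam_gt (Phi n) (d := 0)) ?size_poly0// big_ord0.
pose g' := - g`_k *: Phi k + g.
have sg' : (size g' <= k)%N.
  apply/leq_sizeP => j; rewrite leq_eqVlt => /predU1P[<-|kj].
    have := Phi_monic k; rewrite monicE lead_coefE size_Phi => /eqP e.
    by rewrite /g' coefD coefZ e; ring.
  rewrite /g' coefD coefZ [(Phi k)`_j]nth_default ?size_Phi// mulr0 add0r.
  by rewrite nth_default// (leq_trans gk).
have {1}-> : g = g`_k *: Phi k + g' by rewrite /g' scaleNr addrA subrr add0r.
have [_ _ o] := PhiP.
rewrite inner_linear_r (IH _ sg' (ltnW kn)) (o n k) ?mulr0 ?addr0// => nk.
by rewrite nk ltnn in kn.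
Qed.

Lemma toep_Phi_orth n (j : nat) : (j < n)%N -> toep m j (Phi n) = 0.
Proof.
by move=> jn; rewrite -inner_Xn (@inner_Phi_small n j.+1)// size_polyXn.
Qed.

(** By orthogonality only the top coefficient contributes to the squared norm of [Phi n]. *)
Lemma toep_Phi_neq0 (n : nat) : toep m n (Phi n) != 0.
Proof.
have P0 : Phi n != 0 by rewrite -size_poly_eq0 size_Phi.
have := inner_self_neq0 P0.
have sP : (size (Phi n) <= n.+1)%N by rewrite size_Phi.
rewrite (circle_innerE t lam_gt _ sP) big_ord_recr/= big1 => [|i _].
  have := Phi_monic n; rewrite monicE lead_coefE size_Phi => /eqP ->.
  by rewrite add0r rmorph1 mul1r.
by rewrite toep_Phi_orth ?mulr0.
Qed.

(** The moments are real, so the conjugate polynomial has the same orthogonality; the difference of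
    the two monic polynomials has degree less than [n] and is 0 by nondegeneracy. *)
Lemma conj_Phi n : map_poly Num.conj (Phi n) = Phi n.
Proof.
apply/esym/eqP; rewrite -subr_eq0; apply/eqP.
apply: (toep_nondegenerate (momentN t lam) size_Phi toep_Phi_orth toep_Phi_neq0 (n := n)).
  apply/leq_sizeP => j; rewrite leq_eqVlt coefB coef_map/= => /predU1P[<-|kj].
    have := Phi_monic n; rewrite monicE lead_coefE size_Phi => /eqP ->.
    by rewrite rmorph1 subrr.
  by rewrite nth_default ?size_Phi// rmorph0 subrr.
by move=> j jn; rewrite toepB -conj_toep toep_Phi_orth// rmorph0 subrr.
Qed.

Lemma verblunskyE n : verblunsky Phi n = - (Phi n.+1)`_0.
Proof.
by rewrite /verblunsky horner_coef0 -[in RHS]conj_Phi coef_map.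
Qed.

End Orthogonality.

Local Close Scope classical_set_scope.
Unset Implicit Arguments.

Theorem mainTheorem6 (R : realType) (t lambda : R)
    (Phi : nat -> {poly R[i]})
    (ht : t != 0) (hlambda : - (1 / 2) < lambda)
    (hPhi : monic_OPUC (weight t lambda) Phi) :
  let alpha := verblunsky Phi in
  forall n : nat, (2 <= n)%N ->
    alpha n + alpha (n - 2)%N =
      - (2 / t)%:C *
      ((lambda%:C + (lambda%:C + n%:R) * alpha (n - 1)%N) /
       (1 - alpha (n - 1)%N ^+ 2)).
Proof.
move=> alpha [|[|n]]// _; rewrite !subSS !subn0 /alpha !(verblunskyE hlambda hPhi).
have [sP mP _] := hPhi.
have orth := toep_Phi_orth hlambda hPhi; have nz := toep_Phi_neq0 hlambda hPhi.
(* The index of the statement is now [n + 2], and the first integral at [n + 1] involves [alpha] at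
   [n], [n + 1] and [n + 2]. *)
have E := dPII_first_integral (momentN t lambda) (pearson_moment t hlambda)
  sP mP orth nz n.+1.
have := one_sub_sqr_verblunsky_neq0 (momentN t lambda) sP mP orth nz n.+1.
have tC : t%:C != 0 by rewrite eq_complex /= eqxx andbT.
have t2E : (t / 2)%:C = t%:C / 2 by rewrite rmorphM fmorphV rmorph_nat.
have t2E' : (2 / t)%:C = 2 / t%:C by rewrite rmorphM fmorphV rmorph_nat.
move: E; rewrite t2E t2E'; move: (- _`_0) (- _`_0) (- _`_0) => b c a E b1.
(* The first integral solved for the numerator; dividing uses [t != 0] and [1 - a ^+ 2 != 0]. *)
have -> : lambda%:C + (lambda%:C + n.+2%:R) * a = - (t%:C / 2 * (1 - a ^+ 2) * (c + b)).
  by apply/eqP; rewrite -subr_eq0 -(subrr (- lambda%:C)) -{1}E; apply/eqP; ring.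
by field; rewrite tC b1.
Qed.
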